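(* Let $R$ be a nil-reversible ring. Then $R$ is reduced if $R$ satisfies any one of the following conditions: (1) $R$ is right principally projective or left principally projective; (2) $R$ is semiprime; (3) $R$ is left SF; (4) $R$ is right SF; (5) every simple singular left $R$-module is $W$nil-injective; (6) every simple singular right $R$-module is $W$nil-injective; (7) every maximal essential left ideal of $R$ is $W$nil-injective (as a left $R$-module); (8) every maximal essential right ideal of $R$ is $W$nil-injective (as a right $R$-module).
   Context: All rings are associative with identity and all modules are unital. For a ring $R$, $N(R)$ denotes the set of all nilpotent elements of $R$. For $a\in R$, $l(a)=\{x\in R: xa=0\}$ and $r(a)=\{x\in R: ax=0\}$. A ring $R$ is nil-reversible if $l(a)=r(a)$ for every $a\in N(R)$. $R$ is reduced if it has no non-zero nilpotent elements. $R$ is right (left) principally projective if the right (left) annihilator of each element of $R$ is generated, as a right (left) ideal, by an idempotent. $R$ is left (right) SF if all simple left (right) $R$-modules are flat. A left $R$-module $M$ is $W$nil-injective if for every $0\neq w\in N(R)$ there exists a positive integer $m$ such that $w^m\neq 0$ and every left $R$-homomorphism $f:Rw^m\to M$ extends to a left $R$-homomorphism $R\to M$; right $W$nil-injective modules are defined symmetrically, using $w^mR$. A maximal essential left (right) ideal is a maximal left (right) ideal that is essential in $R$ as a left (right) module. *)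

(* Defs.v *)
From HB Require Import structures.
From mathcomp Require Import all_boot all_algebra.
From mathcomp Require Import boolp.
From mathcomp Require Import freeg.

Set Implicit Arguments.
Unset Strict Implicit.
Unset Printing Implicit Defensive.

Import GRing.Theory.
Local Open Scope ring_scope.
Local Open Scope quotient_scope.

(** Rings are [pzRingType]s, so that the zero ring is allowed.  Left modules
    over [R] are [lmodType R]; right modules over [R] are left modules over the
    converse ring [R^c], i.e. [lmodType R^c], so that [(r : R^c) *: x] is the
    right action [x r].  Left (right) ideals of [R] are the submodules of the
    regular module [R^o] (resp. [R^c^o]), and a notion for right modules is
    the instance at [R^c] of the notion for left modules. *)

(** * Elements and annihilators *)

Section RingNotions.
Variable R : pzRingType.

Definition nilpotent (a : R) : Prop := exists n, a ^+ n = 0.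

Definition reduced : Prop := forall a : R, nilpotent a -> a = 0.

Definition nil_reversible : Prop :=
  forall a : R, nilpotent a -> forall x : R, x * a = 0 <-> a * x = 0.

Definition right_pp : Prop :=
  forall a : R, exists e : R, e * e = e /\
    forall x : R, a * x = 0 <-> exists y : R, x = e * y.

Definition left_pp : Prop :=
  forall a : R, exists e : R, e * e = e /\
    forall x : R, x * a = 0 <-> exists y : R, x = y * e.

End RingNotions.

(** * Submodules *)

Section Submodules.
Variables (R : pzRingType) (V : lmodType R).

Definition submod (S : submodClosed V) : Type := {x : V | x \in S}.

HB.instance Definition _ (S : submodClosed V) := SubChoice.on (submod S).
HB.instance Definition _ (S : submodClosed V) :=
  [SubChoice_isSubLmodule of submod S by <:].

Definition cyclic_submod (v : V) : {pred V} :=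
  fun x => `[< exists a : R, x = a *: v >].

Lemma cyclic_submod_closed (v : V) : submod_closed (cyclic_submod v).
Proof.
split; first by apply/asboolP; exists 0; rewrite scale0r.
move=> a _ _ /asboolP[b ->] /asboolP[c ->]; apply/asboolP.
by exists (a * b + c); rewrite scalerDl scalerA.
Qed.

HB.instance Definition _ (v : V) :=
  GRing.isSubmodClosed.Build R V (cyclic_submod v) (cyclic_submod_closed v).

Definition annihilator (v : V) : {pred R^o} := fun r => (r : R) *: v == 0.

Lemma annihilator_closed (v : V) : submod_closed (annihilator v).
Proof.
split; first by rewrite unfold_in scale0r.
move=> a x y; rewrite !unfold_in => /eqP xv /eqP yv.
by rewrite scalerDl -[a *: x]/(a * x) -scalerA xv yv scaler0 addr0.
Qed.

HB.instance Definition _ (v : V) :=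
  GRing.isSubmodClosed.Build R R^o (annihilator v) (annihilator_closed v).

Definition essential (S : submodClosed V) : Prop :=
  forall T : submodClosed V,
    (forall x, x \in S -> x \in T -> x = 0) -> forall x, x \in T -> x = 0.

Definition maximal_submod (S : submodClosed V) : Prop :=
  (exists x, x \notin S) /\
  forall T : submodClosed V,
    {subset S <= T} -> {subset T <= S} \/ forall x, x \in T.

Definition simple_mod : Prop :=
  (exists x : V, x != 0) /\
  forall S : submodClosed V, (forall x, x \in S -> x = 0) \/ forall x, x \in S.

End Submodules.

Section ModuleNotions.
Variables (R : pzRingType) (V : lmodType R).

Definition singular_mod : Prop := forall v : V, essential (annihilator v).

Definition Wnil_injective : Prop :=
  forall w : R, nilpotent w -> w != 0 ->
  exists m : nat, [/\ (0 < m)%N, w ^+ m != 0 &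
    forall f : {linear submod (cyclic_submod (w ^+ m : R^o)) -> V},
    exists g : {linear R^o -> V}, forall x, g (val x) = f x].

End ModuleNotions.

Definition semiprime (R : pzRingType) : Prop :=
  forall I : submodClosed R^o,
    (forall x r : R, x \in I -> x * r \in I) ->
    (exists n : nat, forall s : seq R,
       size s = n -> {subset s <= I} -> \prod_(x <- s) x = 0) ->
    forall x : R, x \in I -> x = 0.

(** * Tensor products *)

(** The tensor product [A (x)_R M] of a right module [A] and a left module [M]
    is the free abelian group on [A * M] modulo the subgroup generated by the
    balancing relators, that subgroup being the intersection of all the
    subgroups that contain them. *)

Section Tensor.
Variables (R : pzRingType) (A : lmodType R^c) (M : lmodType R).

Local Notation F := {freeg (A * M)%type}.

Definition relator (d : F) : Prop :=
  [\/ exists a a' m, d = << (a + a', m) >> - << (a, m) >> - << (a', m) >>,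
      exists a m m', d = << (a, m + m') >> - << (a, m) >> - << (a, m') >>
    | exists a (r : R) m, d = << ((r : R^c) *: a, m) >> - << (a, r *: m) >>].

Definition tensor_rel : {pred F} :=
  fun d => `[< forall S : zmodClosed F,
                 (forall u, relator u -> u \in S) -> d \in S >].

Lemma tensor_rel_closed : zmod_closed tensor_rel.
Proof.
split; first by apply/asboolP => S _; exact: rpred0.
move=> x y /asboolP xS /asboolP yS; apply/asboolP => S rS.
by rewrite rpredB ?xS ?yS.
Qed.

HB.instance Definition _ :=
  GRing.isZmodClosed.Build F tensor_rel tensor_rel_closed.

Definition tensor : zmodType := Quotient.quot tensor_rel.

Definition to_tensor (d : F) : tensor := \pi_(Quotient.quot tensor_rel) d.

Definition pure (a : A) (m : M) : tensor := to_tensor << (a, m) >>.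

Lemma to_tensorB : {morph to_tensor : x y / x - y}.
Proof. by move=> x y; rewrite /to_tensor /= !piE. Qed.

Lemma to_tensor_eq (x y : F) :
  to_tensor x = to_tensor y <-> x - y \in tensor_rel.
Proof.
rewrite (Quotient.idealrBE tensor_rel x y).
by split => [xy|/eqP//]; apply/eqP.
Qed.

End Tensor.

Section TensorMap.
Variables (R : pzRingType) (A A' : lmodType R^c) (M M' : lmodType R).
Variables (f : {linear A -> A'}) (g : {linear M -> M'}).

Definition free_map : {freeg (A * M)%type} -> {freeg (A' * M')%type} :=
  fglift (fun p => << (f p.1, g p.2) >>).

(** This is [f (x) g]; it does not depend on the representative [repr t], as
    the next lemmas show. *)
Definition tensor_map (t : tensor A M) : tensor A' M' :=
  to_tensor (free_map (repr (t : Quotient.quot (@tensor_rel R A M)))).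

Lemma free_mapB : {morph free_map : x y / x - y}.
Proof. exact: lift_is_additive. Qed.

Lemma free_mapU a m : free_map << (a, m) >> = << (f a, g m) >>.
Proof. by rewrite /free_map liftU scale1r. Qed.

Lemma free_map_rel d :
  d \in @tensor_rel R A M -> free_map d \in @tensor_rel R A' M'.
Proof.
move=> /asboolP dA; apply/asboolP => S rS.
pose T : {pred {freeg (A * M)%type}} := fun x => free_map x \in S.
have T0 : 0 \in T by rewrite unfold_in -(subrr 0) free_mapB subrr rpred0.
have TB : zmod_closed T.
  by split=> // x y xT yT; rewrite unfold_in free_mapB rpredB.
pose TM := GRing.isZmodClosed.Build _ T TB.
pose TP : zmodClosed _ := HB.pack T TM.
apply: (dA TP) => u ru; rewrite [u \in _]unfold_in; apply: rS.
case: ru => [[a [a' [m ->]]]|[a [m [m' ->]]]|[a [r [m ->]]]].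
- by apply: Or31; exists (f a), (f a'), (g m); rewrite !free_mapB !free_mapU linearD.
- by apply: Or32; exists (f a), (g m), (g m'); rewrite !free_mapB !free_mapU linearD.
- by apply: Or33; exists (f a), r, (g m); rewrite !free_mapB !free_mapU !linearZ.
Qed.

Lemma tensor_map_to_tensor d : tensor_map (to_tensor d) = to_tensor (free_map d).
Proof.
apply/to_tensor_eq; rewrite -free_mapB; apply: free_map_rel.
by apply/to_tensor_eq; rewrite /to_tensor reprK.
Qed.

Lemma tensor_map_pure a m : tensor_map (pure a m) = pure (f a) (g m).
Proof. by rewrite /pure tensor_map_to_tensor free_mapU. Qed.

Lemma tensor_mapB : {morph tensor_map : x y / x - y}.
Proof.
move=> x y.
have [[d <-] [e <-]] : (exists d, to_tensor d = x) /\ (exists e, to_tensor e = y).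
  by split; eexists; exact: reprK.
by rewrite -to_tensorB !tensor_map_to_tensor free_mapB to_tensorB.
Qed.

End TensorMap.

(** * Flatness and SF rings *)

Definition flat_left (R : pzRingType) (M : lmodType R) : Prop :=
  forall (A B : lmodType R^c) (f : {linear A -> B}),
    injective f -> injective (tensor_map f (idfun : {linear M -> M})).

Definition flat_right (R : pzRingType) (N : lmodType R^c) : Prop :=
  forall (A B : lmodType R) (g : {linear A -> B}),
    injective g -> injective (tensor_map (idfun : {linear N -> N}) g).

Definition left_SF (R : pzRingType) : Prop :=
  forall M : lmodType R, simple_mod M -> flat_left M.

Definition right_SF (R : pzRingType) : Prop :=
  forall N : lmodType R^c, simple_mod N -> flat_right N.

(* Main.v *)
From HB Require Import structures.
From mathcomp Require Import all_boot all_algebra.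
From mathcomp Require Import boolp classical_sets freeg.
Require Import Defs.

Set Implicit Arguments.
Unset Strict Implicit.
Unset Printing Implicit Defensive.

Import GRing.Theory.
Local Open Scope ring_scope.

(** A ring that is not reduced has some [a != 0] with [a * a = 0].  For such an
    [a], nil-reversibility makes the left annihilator [l(a)] equal to the right
    annihilator [r(a)]; as the former is a left ideal and the latter a right
    ideal, it is a proper two-sided ideal, and it contains [a].

    If [l(a)] or [r(a)] is generated by an idempotent [e], then [a] lies in it,
    so [a] is fixed by [e] on one side, while [e] kills [a] on both sides: hence
    [a = 0].  If [R] is semiprime, the elements [x] of [l(a)] with
    [l(a) * x = 0] form a two-sided ideal of square zero that contains [a]:
    hence [a = 0] again.

    The other conditions are used through a maximal left ideal [L] above [l(a)].
    A key point is that [L] is automatically essential: otherwise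
    [1 = m + e] with [m] in [L] and [e] in a left ideal [T] meeting [L] in [0];
    then [a * e = a - a * m] lies in both, so [e] is in [r(a) = l(a)], inside
    [L], and [e = 0].  Each condition then yields some [c] with [a * c = 0] and
    [1 - c] in [L]; since [r(a) = l(a)] is inside [L], this puts [1] in [L]
    ([reduced_of_one_in_ann_plus_maximal]).
    - If the simple module [R / L] is flat, the tensor of [a] and [1 + L] is
      zero in [a R (x) R / L], because its image in [R (x) R / L] is the tensor
      of [1] and [a + L = 0].  But [l(a)] kills [R / L], so sending [(a x, u)]
      to [x u] is a well defined balanced map, and it takes that tensor to
      [1 + L].  So [1] is in [L], and [c = 0] will do.
    - If [R / L], which is simple and singular, is Wnil-injective, the map
      [R a -> R / L] that sends [r a] to [r + L] extends to [R], so that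
      [1 + L = a (c + L)]; and [a * (a * c) = 0].
    - If [L] itself is Wnil-injective, the inclusion of [R a] in [L] extends to
      [R], so that [a = a * c] with [c] in [L]; and [a * (1 - c) = 0].

    The conditions on right modules are the conditions on left modules for the
    converse ring. *)

(** * Submodules *)

Section SubmodTheory.
Variables (R : pzRingType) (V : lmodType R).

Lemma submodB (S : submodClosed V) x y : x \in S -> y \in S -> x - y \in S.
Proof. exact: (GRing.subsemimod_closedB (GRing.subsemimodClosedP S)).2. Qed.

(** A predicate that is only locally known to be a submodule has to be bundled
    by hand before the order-theoretic notions, which quantify over
    [submodClosed V], apply to it. *)
Definition pack_submod (P : {pred V}) (P_closed : submod_closed P) :
    submodClosed V :=
  let mixin := GRing.isSubmodClosed.Build R V P P_closed in
  HB.pack P mixin.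

Lemma pack_submodE P (P_closed : submod_closed P) x :
  (x \in pack_submod P_closed) = P x.
Proof. by []. Qed.

Lemma add_submod_closed (S T : submodClosed V) :
  submod_closed (fun x => `[< exists u v, [/\ u \in S, v \in T & x = u + v] >]).
Proof.
split; first by apply/asboolP; exists 0, 0; rewrite !rpred0 addr0.
move=> r _ _ /asboolP[u [v [uS vT ->]]] /asboolP[u' [v' [uS' vT' ->]]].
apply/asboolP; exists (r *: u + u'), (r *: v + v'); split.
- by rewrite rpredD ?rpredZ.
- by rewrite rpredD ?rpredZ.
- by rewrite scalerDr addrACA.
Qed.

Lemma maximal_submod_supplement (S T : submodClosed V) x :
    maximal_submod S -> x \in T -> x \notin S ->
  forall y, exists u v, [/\ u \in S, v \in T & y = u + v].
Proof.
move=> [_ maxS] xT xS y; pose ST := pack_submod (add_submod_closed S T).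
have [z zS|STS|/(_ y)/asboolP//] := maxS ST.
  by apply/asboolP; exists z, 0; rewrite rpred0 addr0.
case/negP: xS; apply: STS; apply/asboolP.
by exists 0, x; rewrite rpred0 add0r.
Qed.

End SubmodTheory.

(** * Maximal left ideals *)

Section MaximalLeftIdeal.
Variable R : pzRingType.

Lemma left_idealM (L : submodClosed R^o) (r x : R) : x \in L -> r * x \in L.
Proof. exact: (@rpredZ R R^o L r x). Qed.

Lemma left_ideal1 (L : submodClosed R^o) : (1 : R) \in L -> forall x, x \in L.
Proof. by move=> L1 x; rewrite -[x]mulr1; exact: left_idealM. Qed.

(** Zorn's lemma, on the left ideals above [I] that avoid [1]: maximality among
    those is maximality among all proper left ideals. *)
Lemma exists_maximal_left_ideal (I : submodClosed R^o) : (1 : R) \notin I ->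
  exists2 L : submodClosed R^o, maximal_submod L & {subset I <= L}.
Proof.
move=> I1.
pose P (L : submodClosed R^o) := (1 : R) \notin L /\ {subset I <= L}.
pose T := {L : submodClosed R^o | P L}.
pose le (A B : T) : bool := `[< {subset sval A <= sval B} >].
have PI : P I by split.
have [|r s t /asboolP rs /asboolP st|F Ftot|[L [L1 IL]] maxL] :=
  @ZL_preorder T (exist _ I PI) le.
- by move=> A; apply/asboolP.
- by apply/asboolP => x /rs /st.
- have [[A0 FA0]|F0] := pselect (exists A, F A); last first.
    by exists (exist _ I PI) => A FA; case: F0; exists A.
  (* The union of a chain is a left ideal only if the chain is inhabited. *)
  pose U : {pred R^o} := fun x => `[< exists2 A, F A & x \in sval A >].
  have Ucl : submod_closed U.
    split; first by apply/asboolP; exists A0; rewrite ?rpred0.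
    move=> r x y /asboolP[A FA xA] /asboolP[B FB yB]; apply/asboolP.
    have [/asboolP AB|/asboolP BA] := Ftot A B FA FB.
    - by exists B => //; rewrite rpredD ?rpredZ //; exact: AB.
    - by exists A => //; rewrite rpredD ?rpredZ //; exact: BA.
  have PU : P (pack_submod Ucl).
    split=> [|x xI].
      by apply/negP => /asboolP[[A [A1 IA]] _ /= A1']; rewrite A1' in A1.
    by apply/asboolP; exists A0; rewrite ?(svalP A0).2.
  exists (exist _ _ PU) => A FA; apply/asboolP => x xA.
  by apply/asboolP; exists A.
- exists L => //; split; first by exists (1 : R).
  move=> M LM; have [M1|M1] := boolP ((1 : R) \in M).
    by right; exact: left_ideal1.
  left; have PM : P M by split=> // x /IL /LM.
  by apply/asboolP/(maxL (exist _ M PM))/asboolP.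
Qed.

End MaximalLeftIdeal.

(** * Quotient modules *)

Section QuotientModule.
Variables (R : pzRingType) (V : lmodType R) (S : submodClosed V).

(** A copy of [S] with a head constant, which can carry the structure of
    additive subgroup that the quotient construction asks for. *)
Definition zmod_pred : {pred V} := fun x => x \in S.

Lemma zmod_pred_closed : zmod_closed zmod_pred.
Proof. exact: GRing.subsemimod_closedB (GRing.subsemimodClosedP S). Qed.

HB.instance Definition _ :=
  GRing.isZmodClosed.Build V zmod_pred zmod_pred_closed.

Definition quotient_mod : Type := Quotient.quot zmod_pred.

HB.instance Definition _ := GRing.Zmodule.on quotient_mod.

Definition mod_class (x : V) : quotient_mod := (\pi_(Quotient.quot zmod_pred) x)%qT.

Lemma mod_class_eq x y : mod_class x = mod_class y <-> x - y \in S.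
Proof.
rewrite -[x - y \in S]/(x - y \in zmod_pred) (Quotient.idealrBE zmod_pred x y).
by split => [xy|/eqP//]; apply/eqP.
Qed.

Lemma mod_class_surj (u : quotient_mod) : exists x, u = mod_class x.
Proof. by exists (repr (u : Quotient.quot zmod_pred)); rewrite /mod_class reprK. Qed.

Lemma mod_class0 : mod_class 0 = 0.
Proof. by rewrite /mod_class /= !piE. Qed.

Lemma mod_classD : {morph mod_class : x y / x + y}.
Proof. by move=> x y; rewrite /mod_class /= !piE. Qed.

Lemma mod_class_eq0 x : mod_class x = 0 <-> x \in S.
Proof. by rewrite -mod_class0 mod_class_eq subr0. Qed.

Definition quotient_scale (r : R) (u : quotient_mod) : quotient_mod :=
  mod_class (r *: repr (u : Quotient.quot zmod_pred)).

Lemma quotient_scaleE r x : quotient_scale r (mod_class x) = mod_class (r *: x).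
Proof.
apply/mod_class_eq; rewrite -scalerBr rpredZ //; apply/mod_class_eq.
by rewrite /mod_class reprK.
Qed.

Lemma quotient_scaleA a b u :
  quotient_scale a (quotient_scale b u) = quotient_scale (a * b) u.
Proof. by have [x ->] := mod_class_surj u; rewrite !quotient_scaleE scalerA. Qed.

Lemma quotient_scale1 : left_id 1 quotient_scale.
Proof.
by move=> u; have [x ->] := mod_class_surj u; rewrite quotient_scaleE scale1r.
Qed.

Lemma quotient_scaleDr : right_distributive quotient_scale +%R.
Proof.
move=> r u v; have [[x ->] [y ->]] := (mod_class_surj u, mod_class_surj v).
by rewrite -mod_classD !quotient_scaleE scalerDr mod_classD.
Qed.

Lemma quotient_scaleDl u : {morph quotient_scale^~ u : a b / a + b}.
Proof.
move=> a b /=; have [x ->] := mod_class_surj u.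
by rewrite !quotient_scaleE scalerDl mod_classD.
Qed.

HB.instance Definition _ := GRing.Zmodule_isLmodule.Build R quotient_mod
  quotient_scaleA quotient_scale1 quotient_scaleDr quotient_scaleDl.

Lemma mod_classZ r x : mod_class (r *: x) = r *: mod_class x.
Proof. by rewrite -quotient_scaleE. Qed.

Lemma preim_mod_class_closed (T : submodClosed quotient_mod) :
  submod_closed (fun x => mod_class x \in T).
Proof.
split; first by rewrite unfold_in mod_class0 rpred0.
by move=> r x y xT yT; rewrite unfold_in mod_classD mod_classZ rpredD ?rpredZ.
Qed.

Lemma simple_quotient : maximal_submod S -> simple_mod quotient_mod.
Proof.
move=> [[x xS] maxS]; split.
  by exists (mod_class x); apply: contraNneq xS => /mod_class_eq0.
move=> T; pose T' := pack_submod (preim_mod_class_closed T).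
have [y /mod_class_eq0 y0|T'S|T'V] := maxS T'.
- by rewrite pack_submodE y0 rpred0.
- left=> u; have [y ->] := mod_class_surj u => yT; exact/mod_class_eq0/T'S.
- by right=> u; have [y ->] := mod_class_surj u; exact: T'V.
Qed.

End QuotientModule.

(** Multiplication by [v] carries a left ideal [T] that misses the annihilator of
    the class of [v] to a submodule [T v] that misses [S].  So [T v = 0], and
    [T] was inside that annihilator. *)
Lemma singular_quotient (R : pzRingType) (V : lmodType R) (S : submodClosed V) :
  essential S -> singular_mod (quotient_mod S).
Proof.
move=> essS u T Tann t tT; have [v uE] := mod_class_surj u.
have in_ann r : r *: v \in S -> r \in annihilator u.
  by move/mod_class_eq0; rewrite mod_classZ -uE => /eqP.
pose Tv : {pred V} := fun x => `[< exists2 r : R, (r : R^o) \in T & x = r *: v >].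
have Tv_closed : submod_closed Tv.
  split; first by apply/asboolP; exists 0; rewrite ?rpred0 ?scale0r.
  move=> r _ _ /asboolP[a aT ->] /asboolP[b bT ->]; apply/asboolP.
  exists (r * a + b); last by rewrite scalerDl scalerA.
  by rewrite rpredD //; exact: left_idealM.
apply: (Tann) => //; apply: (in_ann).
suff -> : (t : R) *: v = 0 by rewrite rpred0.
apply: (essS (pack_submod Tv_closed)); last by apply/asboolP; exists t.
move=> _ /[swap] /asboolP[r rT ->] rvS.
by rewrite (Tann r (in_ann _ rvS) rT) scale0r.
Qed.

(** * Maps out of a cyclic submodule *)

Section CyclicModule.
Variables (R : pzRingType) (V : lmodType R) (v : V).

Lemma mem_cyclic_gen : v \in cyclic_submod v.
Proof. by apply/asboolP; exists 1; rewrite scale1r. Qed.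

Definition cyclic_gen : submod (cyclic_submod v) := Sub v mem_cyclic_gen.

Lemma cyclic_coef : exists c : submod (cyclic_submod v) -> R,
  forall y, val y = c y *: v.
Proof.
have /boolp.choice[c cE] : forall y : submod (cyclic_submod v),
    exists r : R, val y = r *: v by move=> y; exact/asboolP/(valP y).
by exists c.
Qed.

Lemma cyclic_lift (U : lmodType R) (u : U) :
    (forall r : R, r *: v = 0 -> r *: u = 0) ->
  exists f : {linear submod (cyclic_submod v) -> U}, f cyclic_gen = u.
Proof.
move=> uv; have [c cE] := cyclic_coef; pose f y := c y *: u.
have fE y r : val y = r *: v -> f y = r *: u.
  move=> yE; apply/eqP; rewrite -subr_eq0 -scalerBl uv //.
  by rewrite scalerBl -cE yE subrr.
have f_lin : linear f.
  move=> r x y; rewrite scalerA -scalerDl; apply: fE.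
  by rewrite !linearP /= !cE scalerA -scalerDl.
pose mixin := GRing.isLinear.Build _ _ _ _ f f_lin.
pose F : {linear submod (cyclic_submod v) -> U} := HB.pack f mixin.
by exists F; rewrite -[RHS]scale1r; apply: fE; rewrite scale1r.
Qed.

(** The element [r *: v] acts as [rho r] does: this depends only on [r *: v]
    because the annihilator of [v] acts as zero.  As [rho] is an action of [R]
    on the side opposite to that of its action on [V], the resulting map is
    balanced.  The action is a bare function, instead of a module over the
    converse ring, so that [R] may itself be a converse ring without bringing in
    the converse of a converse. *)
Lemma cyclic_act (W : zmodType) (rho : R -> W -> W) :
    (forall r, {morph rho r : w w' / w + w'}) ->
    (forall w, {morph rho^~ w : r s / r + s}) ->
    (forall r s w, rho (r * s) w = rho s (rho r w)) ->
    (forall w, rho 1 w = w) ->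
    (forall r, r *: v = 0 -> forall w, rho r w = 0) ->
  exists phi : submod (cyclic_submod v) -> W -> W,
    [/\ forall y y' w, phi (y + y') w = phi y w + phi y' w,
        forall y w w', phi y (w + w') = phi y w + phi y w',
        forall r y w, phi (r *: y) w = phi y (rho r w) &
        forall w, phi cyclic_gen w = w].
Proof.
move=> rhoDr rhoDl rhoM rho1 rho0; have [c cE] := cyclic_coef.
pose phi y w := rho (c y) w.
have phiE y r w : val y = r *: v -> phi y w = rho r w.
  move=> yE; rewrite /phi -[c y](subrK r) rhoDl rho0 ?add0r //.
  by rewrite scalerBl -cE yE subrr.
exists phi; split=> [y y' w|y w w'|r y w|w].
- by rewrite -[RHS]rhoDl; apply: phiE; rewrite raddfD /= !cE scalerDl.
- exact: rhoDr.
- by rewrite -[RHS]rhoM; apply: phiE; rewrite linearZ /= cE scalerA.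
- by rewrite -[RHS]rho1; apply: phiE; rewrite scale1r.
Qed.

End CyclicModule.

(** * Pure tensors *)

Section TensorTheory.
Variables (R : pzRingType) (A : lmodType R^c) (M : lmodType R).

Lemma pureZ (r : R) (x : A) (m : M) :
  pure ((r : R^c) *: x) m = pure x (r *: m).
Proof.
apply/to_tensor_eq/asboolP => S; apply; apply: Or33.
by exists x, r, m.
Qed.

Lemma to_tensor0 : to_tensor (0 : {freeg (A * M)%type}) = 0.
Proof. by rewrite -[X in to_tensor X](subrr 0) to_tensorB subrr. Qed.

Lemma pure0l (m : M) : pure (0 : A) m = 0.
Proof.
rewrite -to_tensor0; apply/to_tensor_eq/asboolP => S SR.
rewrite subr0 -[X in X \in _]opprK rpredN; apply: SR; apply: Or31.
by exists 0, 0, m; rewrite addr0 subrr sub0r.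
Qed.

Lemma pure0r (x : A) : pure x (0 : M) = 0.
Proof. by rewrite -(scale0r (0 : M)) -pureZ scale0r pure0l. Qed.

(** One half of the universal property of the tensor product: the additive
    extension of [phi] to the free group kills the relators, so its kernel is
    one of the subgroups whose intersection defines the tensor product. *)
Lemma balanced_pure_eq0 (G : zmodType) (phi : A -> M -> G) :
    (forall x x' m, phi (x + x') m = phi x m + phi x' m) ->
    (forall x m m', phi x (m + m') = phi x m + phi x m') ->
    (forall (r : R) x m, phi ((r : R^c) *: x) m = phi x (r *: m)) ->
  forall x m, pure x m = 0 -> phi x m = 0.
Proof.
move=> phiDl phiDr phiZ x m; rewrite -to_tensor0 => /to_tensor_eq/asboolP xm.
(* [ssrint.zmodule G] is [G] seen as a module over the integers. *)
pose h : {freeg (A * M)%type} -> ssrint.zmodule G :=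
  fglift (fun p => phi p.1 p.2 : ssrint.zmodule G).
have hB : {morph h : d e / d - e} by exact: lift_is_additive.
have hU y n : h << (y, n) >> = phi y n by rewrite /h liftU scale1r.
pose K : {pred {freeg (A * M)%type}} := fun d => h d == 0.
have K_closed : zmod_closed K.
  split=> [|d e]; first by rewrite unfold_in -(subrr 0) hB subrr.
  by rewrite !unfold_in hB => /eqP-> /eqP->; rewrite subrr.
pose mixin := GRing.isZmodClosed.Build _ K K_closed.
pose ker : zmodClosed _ := HB.pack K mixin.
apply/eqP; rewrite -hU -[X in h X]subr0; apply: (xm ker) => d rd.
rewrite -[_ \in _]/(h d == 0).
case: rd => [[y [y' [n ->]]]|[y [n [n' ->]]]|[y [r [n ->]]]];
  rewrite !hB !hU ?phiDl ?phiDr ?phiZ ?subrr //.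
- by rewrite addrAC addrK subrr.
- by rewrite addrAC addrK subrr.
Qed.

End TensorTheory.

(** * Square-zero elements and the converse ring *)

Lemma nilpotent_sqr0 (R : pzRingType) (a : R) : a * a = 0 -> nilpotent a.
Proof. by exists 2%N; rewrite expr2. Qed.

(** If [a ^+ n.+2 = 0], then [a ^+ n.+1] squares to zero, so the exponent can be
    lowered. *)
Lemma reduced_sqr0 (R : pzRingType) :
  (forall a : R, a * a = 0 -> a = 0) -> reduced R.
Proof.
move=> sqr0 a [n]; elim: n {-2}n (leqnn n) => [|k IH] n lekn an0.
  move: lekn an0; rewrite leqn0 => /eqP->; rewrite expr0 => R0.
  by rewrite -[a]mul1r R0 mul0r.
case: n lekn an0 => [|[|n]] lekn an0; [exact: (IH 0%N)| by rewrite -[a]expr1|].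
apply: (IH n.+1) => //; apply: sqr0.
by rewrite -exprD addSnnS exprD an0 mulr0.
Qed.

Lemma nilpotent_converse (R : pzRingType) (a : R) :
  nilpotent (a : R^c) <-> nilpotent a.
Proof. by split=> -[n an0]; exists n; rewrite -?an0 GRing.revrX. Qed.

Lemma nil_reversible_converse (R : pzRingType) :
  nil_reversible R -> nil_reversible R^c.
Proof. by move=> nrR a /nilpotent_converse/(nrR a) h x; split=> /h. Qed.

Lemma reduced_converse (R : pzRingType) : reduced R^c -> reduced R.
Proof. by move=> redRc a /nilpotent_converse/redRc. Qed.

(** * Annihilators in a nil-reversible ring *)

Section NilReversible.
Variable R : pzRingType.
Hypothesis nrR : nil_reversible R.

(** [l(a) = r(a)] is a right ideal too. *)
Lemma annM (a x r : R) : a * a = 0 -> x * a = 0 -> x * r * a = 0.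
Proof.
move=> /nilpotent_sqr0 na /(nrR na) ax; apply/(nrR na).
by rewrite mulrA ax mul0r.
Qed.

Lemma reduced_right_pp : right_pp R -> reduced R.
Proof.
move=> pp; apply: reduced_sqr0 => a aa; have [e [ee raE]] := pp a.
have /raE[y aE] := aa; have ae : a * e = 0 by apply/raE; exists 1; rewrite mulr1.
have /(nrR (nilpotent_sqr0 aa)) ea := ae.
by rewrite -ea aE mulrA ee.
Qed.

Lemma reduced_left_pp : left_pp R -> reduced R.
Proof.
move=> pp; apply: reduced_sqr0 => a aa; have [e [ee laE]] := pp a.
have /laE[y aE] := aa; have ea : e * a = 0 by apply/laE; exists 1; rewrite mul1r.
have /(nrR (nilpotent_sqr0 aa)) ae := ea.
by rewrite -ae aE -mulrA ee.
Qed.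

(** The two-sided ideal [K] of the elements of [l(a)] that [l(a)] kills from the
    left has square zero, and [a] is in it. *)
Lemma reduced_semiprime : semiprime R -> reduced R.
Proof.
move=> sp; apply: reduced_sqr0 => a aa.
pose K : {pred R^o} := fun x : R =>
  `[< x * a = 0 /\ forall y : R, y * a = 0 -> y * x = 0 >].
have K_closed : submod_closed K.
  split; first by apply/asboolP; split=> [|y _]; rewrite ?mul0r ?mulr0.
  move=> r x y /asboolP[xa annx] /asboolP[ya anny]; apply/asboolP.
  rewrite -[r *: x]/(r * x); split=> [|z za].
    by rewrite mulrDl -mulrA xa ya mulr0 addr0.
  by rewrite mulrDr mulrA annx ?anny ?addr0 //; exact: annM.
apply: (sp (pack_submod K_closed)).
- move=> x r /asboolP[xa annx]; apply/asboolP; split; first exact: annM.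
  by move=> y /annx yx; rewrite mulrA yx mul0r.
- exists 2%N => -[|x [|y []]] // _ sK.
  have /asboolP[xa _] : x \in K by apply: sK; rewrite mem_head.
  have /asboolP[_ anny] : y \in K by apply: sK; rewrite !inE eqxx orbT.
  by rewrite big_cons big_seq1 anny.
- by apply/asboolP; split.
Qed.

(** A nonzero left ideal [T] that meets [L] in [0] would be a supplement of [L].
    If [1 = m + e] accordingly, then [a * e = a - a * m] is in [L] as well as in
    [T], hence zero, and [e], being in [r(a) = l(a)], is in [L] as well as in
    [T], hence zero too. *)
Lemma essential_over_annihilator (a : R) (L : submodClosed R^o) :
    a * a = 0 -> maximal_submod L -> (forall x, x * a = 0 -> x \in L) ->
  essential L.
Proof.
move=> aa maxL annL T LT0 t tT; apply: contrapT => t0.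
have tL : t \notin L by apply/negP => /LT0 /(_ tT).
have [m [e [mL eT e1]]] := maximal_submod_supplement maxL tT tL (1 : R).
have ae : a * e = 0.
  apply: LT0; last exact: left_idealM.
  have -> : a * e = a - a * m.
    by rewrite -[X in X - _]mulr1 e1 mulrDr addrAC subrr add0r.
  by apply: submodB; [exact: annL|exact: left_idealM].
have e0 : e = 0 by apply: LT0 => //; apply/annL/(nrR (nilpotent_sqr0 aa)).
have [[x xL] _] := maxL; case/negP: xL; apply: left_ideal1.
by rewrite [1]e1 e0 addr0.
Qed.

Lemma ann_kills_quotient (a : R) (L : submodClosed R^o) :
    a * a = 0 -> (forall x, x * a = 0 -> x \in L) ->
  forall r, r * a = 0 -> forall u : quotient_mod L, r *: u = 0.
Proof.
move=> aa annL r ra u; have [x ->] := mod_class_surj u.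
by rewrite -mod_classZ; apply/mod_class_eq0/annL; exact: annM.
Qed.

(** The common end of the module-theoretic cases: [c] is in [r(a) = l(a)], which
    is inside [L], so that [1 = (1 - c) + c] would be in [L]. *)
Lemma reduced_of_one_in_ann_plus_maximal :
    (forall (a : R) (L : submodClosed R^o),
       a * a = 0 -> a != 0 -> maximal_submod L -> essential L ->
       (forall x, x * a = 0 -> x \in L) ->
     exists2 c : R, a * c = 0 & (1 : R) - c \in L) ->
  reduced R.
Proof.
move=> H; apply: reduced_sqr0 => a aa; apply: contrapT => /eqP a0.
have ann1 : (1 : R) \notin annihilator (a : R^o).
  by rewrite unfold_in; rewrite -[1 *: _]/(1 * a) mul1r.
have [L maxL annL] := exists_maximal_left_ideal ann1.
have {}annL x : x * a = 0 -> x \in L by move=> xa; apply: annL; exact/eqP.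
have essL := essential_over_annihilator aa maxL annL.
have [c /(nrR (nilpotent_sqr0 aa))/annL cL c1] := H a L aa a0 maxL essL annL.
have [[x xL] _] := maxL; case/negP: xL; apply: left_ideal1.
by have := rpredD c1 cL; rewrite subrK.
Qed.

End NilReversible.

(** * Flat simple modules *)

(** In [R (x) M] the tensor of [a] and [u] is that of [1] and [a *: u], which is
    zero; flatness brings this back along the inclusion of [a R] in [R]. *)
Lemma flat_left_pure (R : pzRingType) (M : lmodType R) (a : R) (u : M) :
  flat_left M -> a *: u = 0 -> pure (cyclic_gen (a : (R^c)^o)) u = 0.
Proof.
move=> flatM au.
pose i : {linear submod (cyclic_submod (a : (R^c)^o)) -> (R^c)^o} := val.
apply: (flatM _ _ i val_inj); rewrite -(pure0l _ u) !tensor_map_pure linear0.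
have unit_scale (r : R) : (r : (R^c)^o) = (r : R^c) *: (1 : (R^c)^o).
  by rewrite -[RHS]/(1 * r) mul1r.
by rewrite [i _](unit_scale a) [0](unit_scale 0) !pureZ /= au scale0r.
Qed.

Lemma flat_right_pure (R : pzRingType) (N : lmodType R^c) (a : R) (u : N) :
  flat_right N -> (a : R^c) *: u = 0 ->
  pure u (cyclic_gen (a : R^o)) = 0.
Proof.
move=> flatN au.
pose i : {linear submod (cyclic_submod (a : R^o)) -> R^o} := val.
apply: (flatN _ _ i val_inj); rewrite -(pure0r _ u) !tensor_map_pure linear0.
have unit_scale (r : R) : (r : R^o) = r *: (1 : R^o).
  by rewrite -[RHS]/(r * 1) mulr1.
by rewrite [i _](unit_scale a) [0](unit_scale 0) -!pureZ /= au scale0r.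
Qed.

(** The balanced map [(a x, u) |-> x u] detects the tensor of [a] and the class of
    [1], which flatness makes zero. *)
Lemma reduced_left_SF (R : pzRingType) :
  nil_reversible R -> left_SF R -> reduced R.
Proof.
move=> nrR sf; apply: (reduced_of_one_in_ann_plus_maximal nrR).
move=> a L aa a0 maxL essL annL; pose M := quotient_mod L.
have kills := ann_kills_quotient nrR aa annL.
pose u : M := mod_class L (1 : R).
have [|||||phi [phiDl phiDr phiZ phi1]] :=
  @cyclic_act R^c (R^c)^o a M (fun (r : R) (m : M) => r *: m).
- by move=> r m m'; rewrite scalerDr.
- by move=> m r s; rewrite scalerDl.
- by move=> r s m; rewrite scalerA.
- by move=> m; rewrite scale1r.
- by move=> r /(nrR _ (nilpotent_sqr0 aa)) ra m; exact: kills ra m.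
have au : a *: u = 0 by exact: kills.
have gu := flat_left_pure (sf M (simple_quotient maxL)) au.
have := balanced_pure_eq0 phiDl phiDr (fun r y m => phiZ r y m) gu.
rewrite phi1 => /mod_class_eq0 L1; exists 0; rewrite ?mulr0 //.
by rewrite -[1 - 0]/((1 : R) - 0 : R^o) subr0.
Qed.

(** Here [L] is a maximal right ideal, that is, a maximal left ideal of the
    converse ring, but the tensor products remain over [R]: [R / L] is now their
    left factor, and the roles of the two arguments of [phi] are exchanged. *)
Lemma reduced_right_SF (R : pzRingType) :
  nil_reversible R -> right_SF R -> reduced R.
Proof.
move=> /nil_reversible_converse nrR sf; apply: reduced_converse.
apply: (reduced_of_one_in_ann_plus_maximal nrR).
move=> a L aa a0 maxL essL annL; pose N := quotient_mod L.
have kills := ann_kills_quotient nrR aa annL.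
pose u : N := mod_class L (1 : R^c).
have [|||||phi [phiDl phiDr phiZ phi1]] :=
  @cyclic_act R R^o a N (fun (r : R) (n : N) => (r : R^c) *: n).
- by move=> r m m'; rewrite scalerDr.
- by move=> m r s; rewrite scalerDl.
- by move=> r s m; rewrite scalerA.
- by move=> m; rewrite scale1r.
- by move=> r /(nrR _ (nilpotent_sqr0 aa)) ra m; exact: kills ra m.
have au : (a : R^c) *: u = 0 by exact: kills.
have gu := flat_right_pure (sf N (simple_quotient maxL)) au.
have := @balanced_pure_eq0 _ _ _ _ (fun n y => phi y n)
  (fun n n' y => phiDr y n n') (fun n y y' => phiDl y y' n)
  (fun r n y => esym (phiZ r y n)) _ _ gu.
rewrite phi1 => /mod_class_eq0 L1; exists 0; rewrite ?mulr0 //.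
by rewrite -[1 - 0]/((1 : R^c) - 0 : (R^c)^o) subr0.
Qed.

(** * Wnil-injective modules *)

(** As [a * a = 0], the power of [a] in the definition of Wnil-injectivity is [a]
    itself.  The map [R a -> V] that sends [a] to [v] extends to [R], and [v'] is
    the value of the extension at [1]. *)
Lemma Wnil_injective_divides (R : pzRingType) (V : lmodType R) (a : R) (v : V) :
    Wnil_injective V -> a * a = 0 -> a != 0 ->
    (forall r : R, r * a = 0 -> r *: v = 0) ->
  exists v' : V, v = a *: v'.
Proof.
move=> injV aa a0 av.
have [[|[|m]] [m_gt0 am0 ext]] := injV a (nilpotent_sqr0 aa) a0 => //; last first.
  by rewrite !exprS mulrA aa mul0r eqxx in am0.
rewrite expr1 in ext.
have [f fv] := @cyclic_lift R R^o a V v av; have [g gE] := ext f.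
exists (g (1 : R)); rewrite -linearZ -fv -gE; congr (g _).
by rewrite -[RHS]/(a * 1) mulr1.
Qed.

(** Dividing the class of [1] in [R / L] by [a] gives [1 - a * c] in [L]. *)
Lemma reduced_simple_singular_Wnil_injective (R : pzRingType) :
    nil_reversible R ->
    (forall M : lmodType R,
       simple_mod M -> singular_mod M -> Wnil_injective M) ->
  reduced R.
Proof.
move=> nrR inj; apply: (reduced_of_one_in_ann_plus_maximal nrR).
move=> a L aa a0 maxL essL annL.
have [|u] := @Wnil_injective_divides _ _ a (mod_class L (1 : R))
  (inj _ (simple_quotient maxL) (singular_quotient essL)) aa a0.
  by move=> r ra; exact: (ann_kills_quotient nrR aa annL).
have [c ->] := mod_class_surj u; rewrite -mod_classZ => /mod_class_eq Lc.
by exists (a * c); rewrite // mulrA aa mul0r.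
Qed.

(** Dividing [a] by itself inside [L] gives [a = a * c] with [c] in [L]. *)
Lemma reduced_maximal_essential_Wnil_injective (R : pzRingType) :
    nil_reversible R ->
    (forall L : submodClosed R^o,
       maximal_submod L -> essential L -> Wnil_injective (submod L)) ->
  reduced R.
Proof.
move=> nrR inj; apply: (reduced_of_one_in_ann_plus_maximal nrR).
move=> a L aa a0 maxL essL annL.
have [|[c cL] /(congr1 val) /= ac] := @Wnil_injective_divides _ _ a
  (Sub a (annL a aa) : submod L) (inj _ maxL essL) aa a0.
  by move=> r ra; apply: val_inj; rewrite linearZ linear0.
exists ((1 : R) - c); first by rewrite mulrBr mulr1 {1}ac subrr.
by rewrite subKr.
Qed.

Theorem proposition2p6 (R : pzRingType) (R_nil_reversible : nil_reversible R)
  (R_cond :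
    (right_pp R \/ left_pp R) \/
    semiprime R \/
    left_SF R \/
    right_SF R \/
    (forall M : lmodType R,
       simple_mod M -> singular_mod M -> Wnil_injective M) \/
    (forall M : lmodType R^c,
       simple_mod M -> singular_mod M -> Wnil_injective M) \/
    (forall L : submodClosed R^o,
       maximal_submod L -> essential L -> Wnil_injective (submod L)) \/
    (forall L : submodClosed (R^c)^o,
       maximal_submod L -> essential L -> Wnil_injective (submod L))) :
  reduced R.
Proof.
have nrRc := nil_reversible_converse R_nil_reversible.
case: R_cond => [[|]|[|[|[|[|[|[|]]]]]]].
- exact: reduced_right_pp.
- exact: reduced_left_pp.
- exact: reduced_semiprime.
- exact: reduced_left_SF.
- exact: reduced_right_SF.
- exact: reduced_simple_singular_Wnil_injective.
- by move/(reduced_simple_singular_Wnil_injective nrRc)/reduced_converse.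
- exact: reduced_maximal_essential_Wnil_injective.
- by move/(reduced_maximal_essential_Wnil_injective nrRc)/reduced_converse.
Qed.
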